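(* Let $\Omega\subset\mathbb{R}^d$ be a domain and $T>0$. Let $\phi\in C_c^1(\Omega\times[0,T])$ be a nonnegative function whose support is contained in a relatively open subset $\mathcal{O}\subset\Omega\times[0,T]$. Let $(u,p)\in L^3_{loc}(\mathcal{O})\times L^{3/2}_{loc}(\mathcal{O})$ be an admissible weak solution in $\mathcal{O}$ of the incompressible Euler equations, let $(U,P)\in C^1(\overline{\mathcal{O}})$ be a local strong solution in $\mathcal{O}$ of the incompressible Euler equations, and assume that $u$ and $U$ coincide on $\mathcal{O}\cap\{t=0\}$, where they take the value $u^0\in C^1(\overline{\mathcal{O}}\cap\{t=0\})$. Let $$E^\phi_{rel}(\tau)=\frac12\int_\Omega\phi(x,\tau)|u(x,\tau)-U(x,\tau)|^2\,dx ,$$ defined for almost every $\tau\in(0,T)$. Then $$\liminf_{\tau\searrow0}E^\phi_{rel}(\tau)=0.$$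
   Context: Since $E^\phi_{rel}$ is defined only for almost every $\tau$, the $\liminf$ is the essential one: it is zero iff there do not exist $\delta>0$ and $T_0>0$ with $E^\phi_{rel}(\tau)\ge\delta$ for almost every $\tau\in(0,T_0)$. The domain $\Omega\subset\mathbb{R}^d$ ($d\ge1$) is not necessarily bounded and no boundary conditions are imposed. The incompressible Euler equations are $$\partial_t u+\operatorname{div}(u\otimes u)+\nabla p=0,\qquad \operatorname{div}u=0,$$ with velocity $u$ ($\mathbb{R}^d$-valued) and scalar pressure $p$. For a relatively open $\mathcal{O}\subset\Omega\times[0,T]$, ''$loc$'' means integrability on compact subsets of $\mathcal{O}$, and $C_c^1(\mathcal{O})$ denotes $C^1$ functions with compact support in $\mathcal{O}$ (they need not vanish at $t=0$ or $t=T$), extended by zero to $\Omega\times[0,T]$. All integrands below, being multiplied by a test function or its derivatives, are understood to be zero outside the support of that test function (the solutions need not be defined outside $\mathcal{O}$). Local strong solution in $\mathcal{O}$: a pair $(U,P)\in C^1(\overline{\mathcal{O}})$ (i.e. $C^1$ with values and first derivatives continuous up to the closure) satisfying the equations pointwise at every $(x,t)\in\mathcal{O}$. Local weak solution in $\mathcal{O}$ with initial datum $u^0$ on $\mathcal{O}\cap\{t=0\}$: a pair $(u,p)\in L^3_{loc}(\mathcal{O};\mathbb{R}^d)\times L^{3/2}_{loc}(\mathcal{O})$ such that for almost every $\tau\in(0,T)$ and every $\zeta\in C_c^1(\mathcal{O};\mathbb{R}^d)$, $$\int_0^\tau\!\!\int_\Omega \partial_t\zeta\cdot u+\nabla\zeta:(u\otimes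 u)+p\operatorname{div}\zeta\,dx\,dt=\int_\Omega u(x,\tau)\cdot\zeta(x,\tau)-u^0(x)\cdot\zeta(x,0)\,dx,$$ and $\int_\Omega u(x,\tau)\cdot\nabla\psi(x,\tau)\,dx=0$ for almost every $\tau\in(0,T)$ and every $\psi\in C_c^1(\mathcal{O})$. Admissible weak solution in $\mathcal{O}$: a local weak solution in $\mathcal{O}$ that satisfies the local energy inequality in $\mathcal{O}$: for every nonnegative $\chi\in C_c^1(\mathcal{O})$ and almost every $\tau\in(0,T)$, $$\int_0^\tau\!\!\int_\Omega\frac12\partial_t\chi|u|^2+\nabla\chi\cdot\left[\left(\frac{|u|^2}{2}+p\right)u\right]dx\,dt\ge\frac12\int_\Omega\chi(x,\tau)|u(x,\tau)|^2dx-\frac12\int_\Omega\chi(x,0)|u^0(x)|^2dx.$$ *)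

(* Defs.v *)
From HB Require Import structures.
From mathcomp Require Import all_boot all_order all_algebra.
From mathcomp Require Import all_classical all_reals all_analysis.
From mathcomp Require Import ess_sup_inf.

Set Implicit Arguments.
Unset Strict Implicit.
Unset Printing Implicit Defensive.

Import Order.TTheory GRing.Theory Num.Theory.
Import numFieldNormedType.Exports.

Local Open Scope classical_set_scope.
Local Open Scope ring_scope.

(* The product sigma-algebra on row vectors, which for T = R is the Borel
   sigma-algebra of R^n. *)
Definition measure_rV_display : measure_display -> measure_display.
Proof. exact. Qed.

Section measurable_rV.
Context {d} {T : sigmaRingType d}.
Variable n : nat.

Definition rV_coord (i : 'I_n) (v : 'rV[T]_n) : T := v ord0 i.

Let rV_set0 : g_sigma_preimage rV_coord set0.
Proof. exact: sigma_algebra0. Qed.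

Let rV_setC A : g_sigma_preimage rV_coord A -> g_sigma_preimage rV_coord (~` A).
Proof. exact: sigma_algebraC. Qed.

Let rV_bigcup (F : _^nat) : (forall i, g_sigma_preimage rV_coord (F i)) ->
  g_sigma_preimage rV_coord (\bigcup_i (F i)).
Proof. exact: sigma_algebra_bigcup. Qed.

HB.instance Definition _ := @isMeasurable.Build (measure_rV_display d)
  'rV[T]_n (g_sigma_preimage rV_coord) rV_set0 rV_setC rV_bigcup.

Lemma measurable_rV_coord (i : 'I_n) : measurable_fun [set: 'rV[T]_n] (rV_coord i).
Proof.
move=> _ Y mY; rewrite setTI; apply: sub_sigma_algebra => /=.
rewrite -bigcup_seq/=; exists i => /=; first by rewrite mem_index_enum.
by exists Y => //; rewrite setTI.
Qed.

End measurable_rV.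

Lemma measurable_fun_rVP d1 d2 (T1 : measurableType d1) (T2 : measurableType d2)
    n (f : T1 -> 'rV[T2]_n) :
  measurable_fun [set: T1] f <->
  forall i, measurable_fun [set: T1] (fun x => f x ord0 i).
Proof.
split=> [mf i|mf].
  exact: (measurableT_comp (measurable_rV_coord i) mf).
move=> _; rewrite /measurable/=.
move=> A mA; rewrite setTI; move: A mA.
suff : g_sigma_preimage (@rV_coord _ T2 n) `<=` [set A | measurable (f @^-1` A)].
  by [].
apply: smallest_sub.
  split => /=; first by rewrite preimage_set0.
  - by move=> A mA; rewrite setTD -preimage_setC; exact: measurableC.
  - by move=> F mF; rewrite preimage_bigcup; exact: bigcupT_measurable.
rewrite -bigcup_seq => A [i _] /= [B mB <-].
by rewrite setTI -[X in measurable X]setTI; exact: mf.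
Qed.

Section lebesgue_rV.
Context {R : realType}.

Definition rV_cons n (z : R * 'rV[R]_n) : 'rV[R]_n.+1 :=
  \row_i (if unlift ord0 i is Some j then z.2 ord0 j else z.1).

Definition rV_uncons n (v : 'rV[R]_n.+1) : R * 'rV[R]_n :=
  (v ord0 ord0, \row_j v ord0 (lift ord0 j)).

Lemma rV_consK n : cancel (@rV_cons n) (@rV_uncons n).
Proof.
move=> [a v]; rewrite /rV_uncons /rV_cons mxE unlift_none; congr pair.
by apply/rowP => j; rewrite !mxE liftK.
Qed.

Lemma measurable_rV_cons n : measurable_fun [set: R * 'rV[R]_n] (@rV_cons n).
Proof.
apply/measurable_fun_rVP => i; rewrite /rV_cons.
under eq_fun do rewrite mxE.
case: unliftP => [j _|_]; last exact: measurable_fst.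
exact: (measurableT_comp (measurable_rV_coord j) measurable_snd).
Qed.

Lemma measurable_rV_uncons n : measurable_fun [set: 'rV[R]_n.+1] (@rV_uncons n).
Proof.
apply: measurable_fun_pair => /=; first exact: measurable_rV_coord.
apply/measurable_fun_rVP => i; under eq_fun do rewrite mxE.
exact: measurable_rV_coord.
Qed.

Section step.
Variables (n : nat) (mu : {sigma_finite_measure set 'rV[R]_n -> \bar R}).

Definition lebesgue_rV_step : set 'rV[R]_n.+1 -> \bar R :=
  pushforward (@lebesgue_measure R \x mu)%E (@rV_cons n).

Let step0 : lebesgue_rV_step set0 = 0%E.
Proof. by rewrite /lebesgue_rV_step /pushforward preimage_set0 measure0. Qed.

Let step_ge0 A : (0 <= lebesgue_rV_step A)%E.
Proof. by rewrite /lebesgue_rV_step /pushforward; exact: measure_ge0. Qed.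

Let mpre (A : set 'rV[R]_n.+1) : measurable A ->
  measurable (@rV_cons n @^-1` A).
Proof.
by move=> mA; rewrite -[X in measurable X]setTI; exact: measurable_rV_cons.
Qed.

Let step_sigma_additive : semi_sigma_additive lebesgue_rV_step.
Proof.
move=> F mF tF mUF; rewrite /lebesgue_rV_step /pushforward preimage_bigcup.
apply: measure_semi_sigma_additive.
- by move=> k; exact: mpre.
- apply/trivIsetP => /= i j _ _ ij; rewrite -preimage_setI.
  by move/trivIsetP : tF => /(_ _ _ _ _ ij) ->//; rewrite preimage_set0.
- by rewrite -preimage_bigcup; exact: mpre.
Qed.

HB.instance Definition _ := isMeasure.Build _ _ _ lebesgue_rV_step
  step0 step_ge0 step_sigma_additive.

Let step_sigma_finite : sigma_finite setT lebesgue_rV_step.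
Proof.
have /sigma_finiteP[F [TF ndF Foo]] := sigma_finiteT (@lebesgue_measure R).
have /sigma_finiteP[G [TG ndG Goo]] := sigma_finiteT mu.
exists (fun k => @rV_uncons n @^-1` (F k `*` G k)).
  apply/seteqP; split => // v _.
  have [[i _ Fi] [j _ Gj]] : (\bigcup_i F i) (rV_uncons v).1 /\
      (\bigcup_i G i) (rV_uncons v).2 by rewrite -TF -TG.
  exists (maxn i j) => //; split.
    by move/subsetPset : (ndF _ _ (leq_maxl i j)); exact.
  by move/subsetPset : (ndG _ _ (leq_maxr i j)); exact.
move=> k; have [mF Fk] := Foo k; have [mG Gk] := Goo k; split.
  rewrite -[X in measurable X]setTI; apply: measurable_rV_uncons => //.
  exact: measurableX.
rewrite /lebesgue_rV_step /pushforward -comp_preimage.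
rewrite (_ : _ \o _ = id) ?preimage_id//; last first.
  by apply/funext => z /=; rewrite rV_consK.
by rewrite product_measure1E// lte_mul_pinfty// ge0_fin_numE.
Qed.

HB.instance Definition _ := @Measure_isSigmaFinite.Build _ _ _
  lebesgue_rV_step step_sigma_finite.

End step.

(* Lebesgue measure on R^n: the n-fold product of lebesgue_measure. *)
Fixpoint lebesgue_rV n : {sigma_finite_measure set 'rV[R]_n -> \bar R} :=
  match n with
  | 0 => dirac (0 : 'rV[R]_0)
  | n'.+1 => lebesgue_rV_step (lebesgue_rV n')
  end.

Lemma lebesgue_rV_box n (A : 'I_n -> set R) :
  (forall i, measurable (A i)) ->
  lebesgue_rV n [set v : 'rV[R]_n | forall i, A i (v ord0 i)] =
  (\prod_(i < n) @lebesgue_measure R (A i))%E.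
Proof.
elim: n => [|n IHn] in A * => mA.
  by rewrite big_ord0 /= diracE mem_set// => -[].
rewrite big_ord_recl /= /lebesgue_rV_step /pushforward.
rewrite -(IHn (fun i => A (lift ord0 i)))//.
rewrite -product_measure1E//; [|exact: mA|]; last first.
  rewrite [X in measurable X](_ : _ =
    \bigcap_(i in [set: 'I_n]) (rV_coord i @^-1` A (lift ord0 i))); last first.
    by apply/seteqP; split => v /= Hv i; move=> *; exact: Hv.
  apply: fin_bigcap_measurable => // i _.
  by rewrite -[X in measurable X]setTI; exact: measurable_rV_coord.
congr (product_measure1 _ _ _).
apply/seteqP; split => -[a v] /=.
  move=> Hv; split => [|i].
    by have := Hv ord0; rewrite /rV_cons mxE unlift_none.
  by have := Hv (lift ord0 i); rewrite /rV_cons mxE liftK.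
by move=> [Ha Hv] i; rewrite /rV_cons mxE; case: unliftP => [j ->|->].
Qed.

End lebesgue_rV.

Section calculus.
Context {R : realType} {V W : normedModType R}.
Implicit Types (D O K : set V) (f : V -> W) (v z : V).

(* Derivative of f at z in the direction v, relative to D: only increments
   h *: v keeping z + h *: v in D are used, so that it is one-sided at the
   endpoints when D = Om `*` `[0, T], and 'D_v f z when D is a
   neighbourhood of z. *)
Definition diff_quotient f v z (h : R) : W := h^-1 *: (f (z + h *: v) - f z).

Definition increments D v z : set_system R :=
  within [set h | D (z + h *: v)] (0 : R)^'.

Definition derivable_within D f v z : Prop :=
  cvg (diff_quotient f v z @ increments D v z).

Definition derive_within D f v z : W :=
  lim (diff_quotient f v z @ increments D v z).

Definition continuous_up_to O K f : Prop :=
  exists2 g : V -> W, {within K, continuous g} & forall z, O z -> g z = f z.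

(* For O relatively open in D: f is C^1 on O, and its values and first
   derivatives extend continuously to K. *)
Definition C1_up_to D O K f : Prop :=
  continuous_up_to O K f /\
  forall v, (forall z, O z -> derivable_within D f v z) /\
            continuous_up_to O K (derive_within D f v).

Definition C1_on D O f : Prop := C1_up_to D O O f.

Definition supp_in D f : set V := closure [set z | D z /\ f z <> 0].

(* C_c^1(O). f is already extended by zero to D: its support is taken in D
   and lies in O. *)
Definition C1c D O f : Prop :=
  [/\ C1_on D O f, compact (supp_in D f) & supp_in D f `<=` O].

Definition relatively_open D O : Prop :=
  exists2 A : set V, open A & O = D `&` A.

End calculus.

Section euler.
Context {R : realType} {d : nat}.
Local Notation space := 'rV[R]_d.
Local Notation spacetime := ('rV[R]_d * R)%type.
Local Notation vol := (lebesgue_rV d).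
Local Notation leb1 := (@lebesgue_measure R).

Definition dot (a b : space) : R := \sum_(i < d) a ord0 i * b ord0 i.

Definition slab (Om : set space) (T : R) : set spacetime := Om `*` `[0, T].

Definition initial_slice (A : set spacetime) : set space := [set x | A (x, 0)].

Definition d_t {W : normedModType R} (D : set spacetime) (f : spacetime -> W) :
  spacetime -> W := derive_within D f (0, 1).

Definition d_x {W : normedModType R} (D : set spacetime) (j : 'I_d)
  (f : spacetime -> W) : spacetime -> W :=
  derive_within D f (delta_mx ord0 j, 0).

Definition grad (D : set spacetime) (f : spacetime -> R) (z : spacetime) : space :=
  \row_j d_x D j f z.

Definition divergence (D : set spacetime) (f : spacetime -> space) (z : spacetime) : R :=
  \sum_(j < d) d_x D j f z ord0 j.

(* L^q_loc(O), through Borel representatives. *)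
Definition Lloc (O : set spacetime) (q : R) (f : spacetime -> R) : Prop :=
  measurable_fun O f /\
  forall K : set spacetime, compact K -> K `<=` O ->
    (vol \x leb1)%E.-integrable K (fun z => (`|f z| `^ q)%:E).

Section solutions.
Variables (Om : set space) (T : R) (O : set spacetime).
Local Notation D := (slab Om T).

Definition strong_solution (U : spacetime -> space) (P : spacetime -> R) : Prop :=
  [/\ C1_up_to D O (closure O) U, C1_up_to D O (closure O) P &
    forall z, O z ->
      (forall i, d_t D U z ord0 i +
                 \sum_(j < d) d_x D j (fun y => U y ord0 i * U y ord0 j) z +
                 d_x D i P z = 0) /\
      divergence D U z = 0].

Variables (u : spacetime -> space) (p : spacetime -> R) (u0 : space -> space).

Definition weak_momentum : Prop :=
  {ae leb1, forall tau, 0 < tau < T ->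
    forall zeta : spacetime -> space, C1c D O zeta ->
    \int[(vol \x leb1)%E]_(z in Om `*` `]0, tau[)
      (dot (d_t D zeta z) (u z) +
       \sum_(i < d) \sum_(j < d)
         d_x D j zeta z ord0 i * (u z ord0 i * u z ord0 j) +
       p z * divergence D zeta z) =
    \int[vol]_(x in Om)
      (dot (u (x, tau)) (zeta (x, tau)) - dot (u0 x) (zeta (x, 0)))}.

Definition weak_divergence_free : Prop :=
  {ae leb1, forall tau, 0 < tau < T ->
    forall psi : spacetime -> R, C1c D O psi ->
    \int[vol]_(x in Om) dot (u (x, tau)) (grad D psi (x, tau)) = 0}.

Definition weak_solution : Prop :=
  [/\ forall i, Lloc O 3 (fun z => u z ord0 i), Lloc O (3 / 2) p,
      weak_momentum & weak_divergence_free].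

Definition local_energy_inequality : Prop :=
  forall chi : spacetime -> R, C1c D O chi -> (forall z, D z -> 0 <= chi z) ->
  {ae leb1, forall tau, 0 < tau < T ->
    \int[(vol \x leb1)%E]_(z in Om `*` `]0, tau[)
      (2^-1 * d_t D chi z * dot (u z) (u z) +
       dot (grad D chi z) ((dot (u z) (u z) / 2 + p z) *: u z)) >=
    2^-1 * \int[vol]_(x in Om) (chi (x, tau) * dot (u (x, tau)) (u (x, tau))) -
    2^-1 * \int[vol]_(x in Om) (chi (x, 0) * dot (u0 x) (u0 x))}.

Definition admissible_weak_solution : Prop :=
  weak_solution /\ local_energy_inequality.

End solutions.

Definition E_rel (Om : set space) (phi : spacetime -> R) (u U : spacetime -> space)
    (tau : R) : \bar R :=
  ((2^-1)%:E * \int[vol]_(x in Om)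
    (phi (x, tau) * dot (u (x, tau) - U (x, tau)) (u (x, tau) - U (x, tau)))%:E)%E.

End euler.

Section ess_liminf.
Context {R : realType}.
Local Notation leb1 := (@lebesgue_measure R).
Implicit Type f : R -> \bar R.

(* Essential liminf as tau decreases to 0. *)
Definition ess_liminf_0right f : \bar R :=
  ereal_sup [set ess_inf (mrestr leb1 (measurable_itv `]0%R, r[)) f
            | r in [set r : R | 0 < r]].

Lemma ess_liminf_0right_eq0 f : (forall t : R, 0 <= f t)%E ->
  ess_liminf_0right f = 0%E <->
  ~ exists2 delta : R, 0 < delta & exists2 t0 : R, 0 < t0 &
      {ae leb1, forall t, 0 < t < t0 -> (delta%:E <= f t)%E}.
Proof.
have aeP (y : \bar R) (r : R) : (y <= ess_inf (mrestr leb1 (measurable_itv `]0%R, r[)) f)%E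
    <-> {ae leb1, forall t, 0 < t < r -> (y <= f t)%E}.
  split=> [/ess_infP|] [N [mN N0 sN]].
    exists (N `&` `]0, r[); split => //; first exact: measurableI.
    move=> t /= /not_implyP[t0r ytf]; split; last by rewrite in_itv/=.
    exact: sN.
  apply/ess_infP; exists (N `|` ~` `]0, r[); split.
  - by apply: measurableU => //; exact: measurableC.
  - rewrite /= /mrestr setIUl setICl setU0.
    apply: (subset_measure0 _ mN) => //; first exact: measurableI.
  - move=> t /= ytf; have [t0r|t0r] := boolP (0 < t < r).
      by left; apply: sN => /=; apply/not_implyP.
    by right; rewrite /= in_itv/=; exact/negP.
move=> f0; split => [sup0 [delta delta0 [t0 t00 /aeP leinf]]|nE].
  suff : (delta%:E <= 0)%E by rewrite lee_fin leNgt delta0.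
  rewrite -sup0; apply: (le_trans leinf); apply: ereal_sup_ubound.
  by exists t0.
apply/eqP; rewrite eq_le; apply/andP; split; last first.
  apply: (@le_trans _ _ (ess_inf (mrestr leb1 (measurable_itv `]0%R, 1%R[)) f)).
    by apply/ess_infP; apply: aeW => t; exact: f0.
  by apply: ereal_sup_ubound; exists 1 => //=.
apply: ge_ereal_sup => _ [r r0 <-]; rewrite leNgt; apply/negP => inf0.
have [delta delta0 leinf] : exists2 delta : R, 0 < delta &
    (delta%:E <= ess_inf (mrestr leb1 (measurable_itv `]0%R, r[)) f)%E.
  case: (ess_inf _ _) inf0 => [a|_|//]; last by exists 1 => //; rewrite leey.
  by rewrite lte_fin => a0; exists a.
by apply: nE; exists delta => //; exists r => //; apply/aeP.
Qed.

End ess_liminf.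

(* Main.v *)
Require Import Defs.
From HB Require Import structures.
From mathcomp Require Import all_boot all_order all_algebra.
From mathcomp Require Import all_classical all_reals all_analysis.
From mathcomp Require Import measurable_realfun ess_sup_inf.
From mathcomp Require Import ring lra.

Set Implicit Arguments.
Unset Strict Implicit.
Unset Printing Implicit Defensive.

Import Order.TTheory GRing.Theory Num.Theory.
Import numFieldNormedType.Exports.

Local Open Scope classical_set_scope.
Local Open Scope ring_scope.

(** Why the statement holds.  Expanding the square,
      E(tau) = 1/2 int phi |u|^2 - int phi u.U + 1/2 int phi |U|^2
    at time tau, and each term is compared with its value at time 0.
    - The local energy inequality with the test function phi bounds the first
      term by 1/2 int phi(0) |u^0|^2 plus the space-time integral F1(tau) of
      an energy flux over Om x (0, tau).
    - The momentum balance may be tested with zeta = phi U: this field is C^1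
      on O by the product rule, and supported in the support of phi.  Hence
      the second term is - int phi(0) |u^0|^2 - F2(tau), with F2(tau) again a
      space-time integral over Om x (0, tau).
    - W = phi |U|^2 is continuous with compact support, so the third term tends
      to 1/2 int phi(0) |u^0|^2.
    The initial values cancel, since U(., 0) = u^0 on the support of phi(., 0),
    and for almost every tau
      0 <= E(tau) <= F1(tau) - F2(tau) + 1/2 (int W(tau) - int W(0)).
    The integrands of F1 and F2 are sums of products of a coefficient that is
    continuous on O and vanishes off a compact part of O ([weight]) and of a
    locally integrable function of (u, p) ([loc_integrable]); by the exponents
    3 and 3/2, Young-type inequalities make |u|^2 u and p u locally integrable.
    Such products are integrable on the slab ([integrable_weight]), so F1 and F2
    vanish as tau tends to 0 ([cvg_integral_small_time]).  Fubini gives the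
    integrability of almost every time slice, without which the square could
    not be expanded under the integral.  Thus E even tends to 0 essentially,
    not only along a sequence of times ([ess_liminf_0right_squeeze]). *)

(** * Borel sets and Lebesgue measure in space-time *)

Lemma ler_coord_norm (R : realType) (d : nat) (v : 'rV[R]_d) (i : 'I_d) :
  `|v ord0 i| <= `|v|.
Proof.
have -> : `|v| = \big[Num.max/0]_ij `|v ij.1 ij.2| by exact: mx_normrE.
exact: (le_bigmax _ (fun ij : 'I_1 * 'I_d => `|v ij.1 ij.2|) (ord0, i)).
Qed.

Section spacetime_measure.
Context {R : realType} {d : nat}.
Local Notation spacetime := ('rV[R]_d * R)%type.
Local Notation vol := (lebesgue_rV d).
Local Notation leb1 := (@lebesgue_measure R).
Implicit Types (O K : set spacetime) (f : spacetime -> R).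

(** The sigma-algebra on space-time is a product one, defined without reference
    to the topology: an open set belongs to it because it is a countable union
    of boxes with rational centres and rational radii. *)
Lemma open_measurable_spacetime O : open O -> measurable O.
Proof.
move=> oO.
pose box (q : 'rV[rat]_d * rat * rat) : set spacetime :=
  [set z : spacetime |
     (forall i, ball (ratr (q.1.1 ord0 i) : R) (ratr q.2 : R) (z.1 ord0 i)) /\
           ball (ratr q.1.2 : R) (ratr q.2) z.2].
have mbox q : measurable (box q).
  rewrite (_ : box q =
    (\bigcap_(i in [set: 'I_d])
       (fun z : spacetime => z.1 ord0 i) @^-1`
         ball (ratr (q.1.1 ord0 i) : R) (ratr q.2 : R))
    `&` (snd @^-1` ball (ratr q.1.2 : R) (ratr q.2 : R))); last first.
    apply/seteqP; split => z [H1 H2]; split => // i.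
      by move=> _; exact: H1.
    exact: H1.
  apply: measurableI.
    apply: fin_bigcap_measurable => // i _.
    rewrite -[X in measurable X]setTI.
    have mi : measurable_fun [set: spacetime] (fun z : spacetime => z.1 ord0 i).
      exact: (measurableT_comp (measurable_rV_coord i) measurable_fst).
    by apply: mi => //; exact: measurable_ball.
  rewrite -[X in measurable X]setTI; apply: measurable_snd => //.
  exact: measurable_ball.
rewrite (_ : O = \bigcup_q (if `[< box q `<=` O >] then box q else set0)).
  apply: countable_bigcupT_measurable; first exact: countableP.
  by move=> q; case: ifPn.
apply/seteqP; split => [z Oz|z [q _]]; last by case: ifPn => // /asboolP; exact.
have /nbhs_ballP[e /= e0 zeO] : nbhs z O by exact: open_nbhs_nbhs.
have [r] := rat_in_itvoo (divr_gt0 e0 (@ltr0n R 2)).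
rewrite in_itv/= => /andP[r0 re].
have near_rat (x : R) : {q : rat | ball x (ratr r) (ratr q)}.
  apply: cid.
  have [|q] := @rat_in_itvoo R (x - ratr r) (x + ratr r).
    by rewrite ltrD2l gtrN.
  rewrite in_itv/= => /andP[qx xq]; exists q.
  by rewrite /ball/= ltr_distlC qx xq.
pose q : 'rV[rat]_d * rat * rat :=
  (\row_i sval (near_rat (z.1 ord0 i)), sval (near_rat z.2), r).
(* r < e / 2 leaves room to go from z to the rational centre and back to y *)
have e2 : (ratr r + ratr r <= e :> R) by lra.
exists q => //; rewrite asboolT; last first.
  move=> y [H1 H2]; apply: zeO; split => /=.
    split => // i j; rewrite (ord1 i).
    apply: (le_ball e2); apply: (ball_triangle _ (H1 j)).
    by rewrite mxE; exact: (svalP (near_rat _)).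
  by apply: (le_ball e2); apply: (ball_triangle _ H2); exact: (svalP (near_rat _)).
split => [i|] /=; first by rewrite mxE; apply: ball_sym; exact: (svalP (near_rat _)).
by apply: ball_sym; exact: (svalP (near_rat _)).
Qed.

Lemma compact_measurable_spacetime K : compact K -> measurable K.
Proof.
move=> cK; rewrite -(setCK K); apply: measurableC.
apply: open_measurable_spacetime; apply: closed_openC.
exact: compact_closed (@norm_hausdorff _ _) cK.
Qed.

Lemma open_measurable_rV (A : set 'rV[R]_d) : open A -> measurable A.
Proof.
move=> oA.
have mA : measurable (fst @^-1` A : set spacetime).
  by apply: open_measurable_spacetime; apply: open_comp => // z _; exact: cvg_fst.
rewrite [A](_ : _ = (fun x => (x, 0) : spacetime) @^-1` (fst @^-1` A))//.
by rewrite -[X in measurable X]setTI; exact: measurable_pair2.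
Qed.

Lemma within_continuous_measurable O f : measurable O ->
  {within O, continuous f} -> measurable_fun O f.
Proof.
move=> mO /continuousP cf; apply: (measurability _ (RGenOpens.measurableE R)).
move=> _ [_ [a [b ->] <-]].
have oab : open `]a, b[%classic by exact: interval_open.
have /open_subspaceP[V oV VO] := cf _ oab.
by rewrite setIC -VO; apply: measurableI => //; exact: open_measurable_spacetime.
Qed.

Lemma compact_fin_vol (A : set 'rV[R]_d) : measurable A ->
  bounded_set A -> (vol A < +oo)%E.
Proof.
move=> mA [M [_ AM]]; pose M1 := `|M| + 1.
have M1gt : M < M1 by rewrite (le_lt_trans (ler_norm M))// ltrDl.
apply: (@le_lt_trans _ _
    (vol [set v : 'rV[R]_d | forall i : 'I_d, `[- M1, M1]%classic (v ord0 i)])).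
  apply: le_measure; rewrite ?inE//.
    rewrite [X in measurable X](_ : _ =
      \bigcap_(i in [set: 'I_d]) (rV_coord i @^-1` `[- M1, M1]%classic)); last first.
      by apply/seteqP; split => v /= Hv i; move=> *; exact: Hv.
    apply: fin_bigcap_measurable => // i _.
    by rewrite -[X in measurable X]setTI; exact: measurable_rV_coord.
  move=> v Av i /=; rewrite in_itv/= -ler_norml.
  by apply: le_trans (AM _ M1gt _ Av); exact: ler_coord_norm.
rewrite (lebesgue_rV_box (A := fun=> `[- M1, M1]%classic))//.
have := @lebesgue_measure_itv R `[- M1, M1]; move=> /= ->.
case: ifP => _; first by rewrite prodEFin ltry.
by rewrite prodEFin ltry.
Qed.

End spacetime_measure.

(** * Calculus with derivatives relative to a set *)

Section within_calculus.
Context {R : realType} {V W : normedModType R}.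
Implicit Types (D O K : set V) (f : V -> W) (g : V -> R) (v z : V).

(** Extending continuously to O itself is no extension: on O the witness of
    [continuous_up_to] coincides with f. *)
Lemma continuous_up_to_refl O f :
  continuous_up_to O O f <-> {within O, continuous f}.
Proof.
split=> [[g cg gf]|cf]; last by exists f.
by apply: subspace_eq_continuous cg => z; rewrite inE => /gf.
Qed.

Lemma C1_up_to_subset D O O' K K' f : O' `<=` O -> K' `<=` K ->
  C1_up_to D O K f -> C1_up_to D O' K' f.
Proof.
move=> OO KK [[g cg gf] C1f]; split.
  by exists g; [exact: continuous_subspaceW cg|move=> z /OO /gf].
move=> v; have [df [g' cg' gf']] := C1f v; split; first by move=> z /OO; exact: df.
by exists g'; [exact: continuous_subspaceW cg'|move=> z /OO /gf'].
Qed.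

Lemma within_continuousZ O g f : {within O, continuous g} ->
  {within O, continuous f} -> {within O, continuous (fun z => g z *: f z)}.
Proof.
move=> /subspace_continuousP cg /subspace_continuousP cf.
by apply/subspace_continuousP => z Oz; apply: cvgZ; [exact: cg|exact: cf].
Qed.

Lemma increments_cvg0 D v z : increments D v z --> (0 : R).
Proof. exact: (cvg_trans (cvg_within _) (cvg_within _)). Qed.

Lemma increments_cvg D v z : z + h *: v @[h --> increments D v z] --> z.
Proof.
rewrite -[X in _ --> X]addr0 -(scale0r v); apply: cvgD; first exact: cvg_cst.
by apply: cvgZr_tmp; exact: increments_cvg0.
Qed.

Lemma derive_withinP D f v z (l : W) {FF : ProperFilter (increments D v z)} :
  diff_quotient f v z @ increments D v z --> l ->
  derivable_within D f v z /\ derive_within D f v z = l.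
Proof.
move=> fl; split; first by apply/cvg_ex; exists l.
exact: (cvg_lim (@norm_hausdorff _ _) fl).
Qed.

(** The product rule for any set of admissible increments: continuity of f along
    the increments follows from the convergence of its difference quotient. *)
Lemma cvg_diff_quotientZ D g f v z (a : R) (b : W) :
  diff_quotient g v z @ increments D v z --> a ->
  diff_quotient f v z @ increments D v z --> b ->
  diff_quotient (fun y => g y *: f y) v z @ increments D v z -->
    a *: f z + g z *: b.
Proof.
move=> ga fb.
have cf : f (z + h *: v) @[h --> increments D v z] --> f z.
  have : f z + h *: diff_quotient f v z h @[h --> increments D v z] --> f z.
    rewrite -[X in _ --> X]addr0 -(scale0r b); apply: cvgD; first exact: cvg_cst.
    by apply: cvgZ => //; exact: increments_cvg0.
  apply: cvg_trans; apply: near_eq_cvg.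
  have : \forall h \near increments D v z, h != 0.
    by apply: cvg_within; exact: (withinT _ (nbhs_filter _)).
  apply: filterS => h h0.
  by rewrite /diff_quotient scalerA divff// scale1r addrC subrK.
rewrite (_ : diff_quotient _ v z = fun h =>
    diff_quotient g v z h *: f (z + h *: v) + g z *: diff_quotient f v z h).
  by apply: cvgD; [exact: cvgZ|apply: cvgZ => //; exact: cvg_cst].
apply/funext => h; rewrite /diff_quotient.
have scaleE (a' b' c' : R) (w w' : W) :
    c' *: (a' *: w - b' *: w') = (c' *: (a' - b')) *: w + b' *: (c' *: (w - w')).
  rewrite (_ : c' *: (a' - b') = c' * (a' - b'))//.
  rewrite -(scalerA c' (a' - b')) (scalerA b' c') (mulrC b' c').
  rewrite -(scalerA c' b') -scalerDr; congr (_ *: _).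
  by rewrite scalerBl scalerBr addrA subrK.
exact: scaleE.
Qed.

Lemma supp_in_eq0 D f z : D z -> ~ supp_in D f z -> f z = 0.
Proof.
move=> Dz; apply: contra_notP => fz0; apply: subset_closure.
by split => //; exact/eqP.
Qed.

(** Properness of the filter is what makes the limit of the vanishing difference
    quotients equal to 0; along an empty set of increments, [lim] is arbitrary. *)
Lemma derive_within_eq0 D K f v z {FF : ProperFilter (increments D v z)} :
  closed K -> (forall y, D y -> ~ K y -> f y = 0) ->
  D z -> ~ K z -> derive_within D f v z = 0.
Proof.
move=> cK f0 Dz Kz; suff fl : diff_quotient f v z @ increments D v z --> (0 : W).
  by have [_ ->] := derive_withinP fl.
have : cst (0 : W) @ increments D v z --> (0 : W) by exact: cvg_cst.
apply: cvg_trans; apply: near_eq_cvg.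
have DF : \forall h \near increments D v z, D (z + h *: v).
  by apply: (withinT _ (dnbhs_filter _)).
have nK : nbhs z (~` K).
  by apply: open_nbhs_nbhs; split => //; exact: closed_openC.
have KF : \forall h \near increments D v z, ~ K (z + h *: v).
  exact: (@increments_cvg D v z _ nK).
apply: filterS2 DF KF => h Dh Kh.
by rewrite /diff_quotient (f0 _ Dz Kz) (f0 _ Dh Kh) subrr scaler0.
Qed.

End within_calculus.

(** The test function of the momentum balance is of this form: f is controlled
    on O only, and the cut-off g removes what happens elsewhere. *)
Lemma C1c_scale (R : realType) (V W : normedModType R) (D O : set V)
    (g : V -> R) (f : V -> W) :
  (forall z v, O z -> ProperFilter (increments D v z)) ->
  O `<=` D -> C1c D D g -> supp_in D g `<=` O ->
  C1_up_to D O (closure O) f -> C1c D O (fun z => g z *: f z).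
Proof.
move=> PF OD [C1g cpg _] gO C1f.
have [/(continuous_up_to_refl O g).1 cg dg] := C1_up_to_subset OD OD C1g.
have [/(continuous_up_to_refl O f).1 cf df] :=
  C1_up_to_subset (@subset_refl _ O) (@subset_closure _ O) C1f.
have sfg : supp_in D (fun z => g z *: f z) `<=` supp_in D g.
  apply: closure_subset => z [Dz gf0]; split => // g0.
  by apply: gf0; rewrite g0 scale0r.
split; last exact: subset_trans gO.
- split; first exact/continuous_up_to_refl/within_continuousZ.
  move=> v; have [dgv /(continuous_up_to_refl O _).1 cdg] := dg v.
  have [dfv /(continuous_up_to_refl O _).1 cdf] := df v.
  have gfv z (Oz : O z) := @derive_withinP _ _ _ D _ v z _ (PF z v Oz)
    (cvg_diff_quotientZ (dgv z Oz) (dfv z Oz)).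
  split => [z /gfv[]//|].
  exists (fun z => derive_within D g v z *: f z + g z *: derive_within D f v z).
    have /subspace_continuousP c1 := within_continuousZ cdg cf.
    have /subspace_continuousP c2 := within_continuousZ cg cdf.
    apply/subspace_continuousP => z Oz; apply: cvgD; [exact: c1|exact: c2].
  by move=> z /gfv[_ ->].
- by apply: subclosed_compact cpg sfg; exact: closed_closure.
Qed.

(** Every direction is admissible at every point of the slab, up to a sign:
    Om is open, and at time z.2 there is room of size T / 2 either forwards or
    backwards. *)
Lemma increments_proper (R : realType) (d : nat) (Om : set 'rV[R]_d) (T : R) :
  open Om -> 0 < T -> forall z v, slab Om T z ->
  ProperFilter (increments (slab Om T) v z).
Proof.
move=> oOm T0 z v [/= Omz]; rewrite in_itv/= => /andP[z0 zT].
apply: Build_ProperFilter_ex => P [e /= e0 eP].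
have [r /= r0 rOm] : \forall h \near (0 : R), Om (z.1 + h *: v.1).
  have : z.1 + h *: v.1 @[h --> (0 : R)] --> z.1.
    rewrite -[X in _ --> X]addr0 -(scale0r v.1); apply: cvgD; first exact: cvg_cst.
    by apply: cvgZr_tmp; exact: cvg_id.
  by apply; exact: open_nbhs_nbhs.
have v1 : 0 < `|v.2| + 1 by rewrite ltr_wpDl.
pose h0 := Num.min (Num.min (e / 2) (r / 2)) (T / 2 / (`|v.2| + 1)).
have h00 : 0 < h0 by rewrite !lt_min !divr_gt0.
have h0e : h0 < e by rewrite !gt_min; apply/orP; left; apply/orP; left; lra.
have h0r : h0 < r by rewrite !gt_min; apply/orP; left; apply/orP; right; lra.
have h0v : `|h0 * v.2| <= T / 2.
  rewrite normrM (gtr0_norm h00).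
  have : h0 * (`|v.2| + 1) <= T / 2 by rewrite -ler_pdivlMr// ge_min lexx orbT.
  by apply: le_trans; rewrite ler_wpM2l ?lerDl ?ltW.
have [h [h0E hT]] : exists h, (`|h| = h0) /\ (0 <= z.2 + h * v.2 <= T).
  move: h0v; rewrite ler_norml => /andP[Hl Hr].
  have [zT2|zT2] := lerP z.2 (T / 2); have [v0|v0] := lerP 0 (h0 * v.2).
  - by exists h0; split; [exact: gtr0_norm|apply/andP; split; lra].
  - exists (- h0); split; first by rewrite normrN gtr0_norm.
    by rewrite mulNr; apply/andP; split; lra.
  - exists (- h0); split; first by rewrite normrN gtr0_norm.
    by rewrite mulNr; apply/andP; split; lra.
  - by exists h0; split; [exact: gtr0_norm|apply/andP; split; lra].
exists h; apply: eP => /=.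
- by rewrite sub0r normrN h0E.
- by rewrite -normr_gt0 h0E.
- split => /=; last by rewrite in_itv.
  by apply: rOm => /=; rewrite sub0r normrN h0E.
Qed.

(** * Locally integrable functions and their compactly supported coefficients *)

Lemma ler_prod3_cubes (R : realFieldType) (a b c : R) :
  0 <= a -> 0 <= b -> 0 <= c -> a * b * c <= a ^+ 3 + b ^+ 3 + c ^+ 3.
Proof.
move=> a0 b0 c0.
have cube_le (x y z m : R) : 0 <= x -> 0 <= y -> 0 <= z ->
    x <= m -> y <= m -> z <= m -> x * y * z <= m ^+ 3.
  move=> x0 y0 z0 xm ym zm; rewrite exprS expr2 mulrA.
  by apply: ler_pM => //; [exact: mulr_ge0|exact: ler_pM].
pose m := Num.max (Num.max a b) c.
apply: (@le_trans _ _ (m ^+ 3)); first by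
  apply: cube_le => //; rewrite !le_max lexx ?orbT.
have a3 := exprn_ge0 3 a0; have b3 := exprn_ge0 3 b0; have c3 := exprn_ge0 3 c0.
by rewrite /m; case: (leP (Num.max a b) c) => _; case: (leP a b) => _; lra.
Qed.

(** A form of Young's inequality for the conjugate exponents 3/2 and 3: according
    to whether a <= b^2, one of the two terms alone bounds the product. *)
Lemma ler_prod_powR32_cube (R : realType) (a b : R) : 0 <= a -> 0 <= b ->
  a * b <= a `^ (3 / 2) + b ^+ 3.
Proof.
move=> a0 b0; have [ab|ba] := lerP a (b ^+ 2).
  apply: (@le_trans _ _ (b ^+ 3)); last by rewrite lerDr powR_ge0.
  by rewrite exprSr ler_wpM2r.
apply: (@le_trans _ _ (a `^ (3 / 2))); last by rewrite lerDl exprn_ge0.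
have -> : (3 / 2 : R) = 1 + 2^-1 by lra.
have a00 : 0 < a by apply: le_lt_trans ba; exact: sqr_ge0.
rewrite powRD; last by rewrite gt_eqF ?implybT.
rewrite powRr1// ler_wpM2l// powR12_sqrt//.
by rewrite -(ger0_norm b0) -sqrtr_sqr ler_wsqrtr// ltW.
Qed.

Section local_integrability.
Context {R : realType} {d : nat}.
Local Notation spacetime := ('rV[R]_d * R)%type.
Local Notation vol := (lebesgue_rV d).
Local Notation leb1 := (@lebesgue_measure R).
Local Notation mu := (vol \x leb1)%E.
Implicit Types (O D K : set spacetime) (f m : spacetime -> R).

Lemma integrable_add D f m : measurable D -> mu.-integrable D (EFin \o f) ->
  mu.-integrable D (EFin \o m) -> mu.-integrable D (EFin \o (fun z => f z + m z)).
Proof. by move=> mD; exact: integrableD. Qed.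

Lemma integrable_bigsum (I : finType) D (F : I -> spacetime -> R) : measurable D ->
  (forall i, mu.-integrable D (EFin \o F i)) ->
  mu.-integrable D (EFin \o (fun z => \sum_i F i z)).
Proof.
move=> mD iF.
have := @integrable_sum _ _ _ mu D mD I (index_enum I) xpredT (fun i => EFin \o F i).
move=> /(_ (fun i _ => iF i)); apply: eq_integrable => // z _.
by rewrite /= -sumEFin.
Qed.

(** A compact set lies in the product of a ball and a bounded interval. *)
Lemma compact_fin_measure K : compact K -> (mu K < +oo)%E.
Proof.
move=> cK; have [M [_ KM]] := compact_bounded cK; pose M1 := `|M| + 1.
have M1gt : M < M1 by rewrite (le_lt_trans (ler_norm M))// ltrDl.
pose B : set 'rV[R]_d := [set x | `|x| <= M1].
have cB : closed B.
  rewrite [B](_ : _ = Num.norm @^-1` [set y | y <= M1])//.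
  by apply: closed_comp => [x _|]; [exact: norm_continuous|exact: closed_le].
have mB : measurable B.
  rewrite -(setCK B); apply: measurableC.
  by apply: open_measurable_rV; exact: closed_openC.
have volB : (vol B < +oo)%E.
  apply: compact_fin_vol => //; exists M1; split; first exact: num_real.
  by move=> r M1r x Bx; exact: le_trans Bx (ltW M1r).
apply: (@le_lt_trans _ _ (mu (B `*` `[- M1, M1]%classic))).
  apply: le_measure; rewrite ?inE//.
  - exact: compact_measurable_spacetime.
  - exact: measurableX.
  - move=> z Kz; have := KM _ M1gt z Kz; rewrite /= prod_normE ge_max => /andP[z1 z2].
    by split => //=; rewrite in_itv/= -ler_norml.
rewrite product_measure1E//.
have := @lebesgue_measure_itv R `[- M1, M1]; move=> /= ->.
rewrite lte_mul_pinfty// ?ge0_fin_numE//.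
by case: ifP; rewrite ltry.
Qed.

(** The signed counterpart of [Lloc O 1], stable under sums of terms of varying
    sign. *)
Definition loc_integrable O m := measurable_fun O m /\
  forall K, compact K -> K `<=` O -> mu.-integrable K (EFin \o m).

Section closure_properties.
Variables (O : set spacetime) (mO : measurable O).

Let mK K : compact K -> measurable K.
Proof. exact: compact_measurable_spacetime. Qed.

Lemma loc_integrable_add f m : loc_integrable O f -> loc_integrable O m ->
  loc_integrable O (fun z => f z + m z).
Proof.
move=> [mf fi] [mm mi]; split; first exact: measurable_funD.
by move=> K cK KO; apply: integrable_add; [exact: mK|exact: fi|exact: mi].
Qed.

Lemma loc_integrable_scale (k : R) m : loc_integrable O m ->
  loc_integrable O (fun z => k * m z).
Proof.
move=> [mm mi]; split; first exact: (measurable_funM (measurable_cst k) mm).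
move=> K cK KO.
exact: (@integrableZl _ _ _ mu K (mK cK) k (EFin \o m) (mi K cK KO)).
Qed.

Lemma loc_integrable_sum (I : finType) (F : I -> spacetime -> R) :
  (forall i, loc_integrable O (F i)) -> loc_integrable O (fun z => \sum_i F i z).
Proof.
move=> iF; split.
  by apply: measurable_sum => i; have [] := iF i.
move=> K cK KO; apply: integrable_bigsum; first exact: mK.
by move=> i; have [_] := iF i; exact.
Qed.

(** Constants are in every local Lebesgue space, so products of fewer than three
    factors are instances of [loc_integrable_mul3] and [loc_integrable_mul32]. *)
Lemma Lloc_cst (q k : R) : Lloc O q (cst k).
Proof.
split=> // K cK KO; apply/integrableP; split.
  exact: (measurable_cst (`|k| `^ q)%:E).
rewrite (eq_integral (cst (`|k| `^ q)%:E)); last first.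
  by move=> z _; rewrite /= ger0_norm ?powR_ge0.
rewrite integral_cst//; last exact: mK.
by rewrite lte_mul_pinfty// ?lee_fin ?powR_ge0//; exact: compact_fin_measure.
Qed.

Lemma loc_integrable_le f m : measurable_fun O m -> loc_integrable O f ->
  (forall z, O z -> `|m z| <= f z) -> loc_integrable O m.
Proof.
move=> mm [mf fi] mlef; split => // K cK KO.
apply: le_integrable (fi K cK KO); first exact: mK.
  by apply/measurable_EFinP; exact: measurable_funS mm.
move=> z Kz /=; rewrite lee_fin (le_trans (mlef _ (KO _ Kz)))//.
exact: ler_norm.
Qed.

Lemma Lloc_powR (q : R) m : Lloc O q m -> loc_integrable O (fun z => `|m z| `^ q).
Proof.
move=> [mm mi]; split => //.
apply: (measurableT_comp (measurable_powR q)).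
exact: measurableT_comp.
Qed.

Lemma loc_integrable_mul3 a b c : Lloc O 3 a -> Lloc O 3 b -> Lloc O 3 c ->
  loc_integrable O (fun z => a z * b z * c z).
Proof.
move=> la lb lc.
apply: (@loc_integrable_le
    (fun z => `|a z| `^ 3 + `|b z| `^ 3 + `|c z| `^ 3)).
- have [? _] := la; have [? _] := lb; have [? _] := lc.
  by apply: measurable_funM => //; exact: measurable_funM.
- by apply: loc_integrable_add; [apply: loc_integrable_add|]; exact: Lloc_powR.
- by move=> z _; rewrite !powR_mulrn// !normrM; exact: ler_prod3_cubes.
Qed.

Lemma loc_integrable_mul2 a b : Lloc O 3 a -> Lloc O 3 b ->
  loc_integrable O (fun z => a z * b z).
Proof.
move=> la lb; have := loc_integrable_mul3 la lb (Lloc_cst 3 1).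
by under eq_fun do rewrite mulr1.
Qed.

Lemma loc_integrable_Lloc3 a : Lloc O 3 a -> loc_integrable O a.
Proof.
move=> la; have := loc_integrable_mul2 la (Lloc_cst 3 1).
by under eq_fun do rewrite mulr1.
Qed.

Lemma loc_integrable_cst (k : R) : loc_integrable O (cst k).
Proof. exact/loc_integrable_Lloc3/Lloc_cst. Qed.

Lemma loc_integrable_mul32 p a : Lloc O (3 / 2) p -> Lloc O 3 a ->
  loc_integrable O (fun z => p z * a z).
Proof.
move=> lp la.
apply: (@loc_integrable_le (fun z => `|p z| `^ (3 / 2) + `|a z| `^ 3)).
- by have [? _] := lp; have [? _] := la; exact: measurable_funM.
- by apply: loc_integrable_add; exact: Lloc_powR.
- by move=> z _; rewrite !powR_mulrn// !normrM; exact: ler_prod_powR32_cube.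
Qed.

Lemma loc_integrable_Lloc32 p : Lloc O (3 / 2) p -> loc_integrable O p.
Proof.
move=> lp; have := loc_integrable_mul32 lp (Lloc_cst 3 1).
by under eq_fun do rewrite mulr1.
Qed.

End closure_properties.

(** The coefficients which the test functions contribute to the integrands.
    Continuity is relative to O rather than to D because in a product such as
    w = phi f the factor f is only controlled on O. *)
Definition weight D O (w : spacetime -> R) := {within O, continuous w} /\
  exists K, [/\ compact K, K `<=` O & forall z, D z -> ~ K z -> w z = 0].

Lemma within_continuous_comp (W : normedModType R) O (f : spacetime -> W) (h : W -> R) :
  {within O, continuous f} -> continuous h -> {within O, continuous (h \o f)}.
Proof.
move=> /subspace_continuousP cf ch; apply/subspace_continuousP => z Oz.
by apply: cvg_comp (cf z Oz) _; exact: ch.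
Qed.

Lemma weight_C1c (W : normedModType R) D O (f : spacetime -> W) (h : W -> R) :
  continuous h -> h 0 = 0 -> C1c D O f -> weight D O (h \o f).
Proof.
move=> ch h0 [[/(continuous_up_to_refl _ _).1 cf _] cK KO]; split.
  exact: within_continuous_comp.
by exists (supp_in D f); split => // z Dz Kz /=; rewrite (supp_in_eq0 Dz Kz).
Qed.

Lemma weight_derive_within (W : normedModType R) D O (f : spacetime -> W) (h : W -> R) v :
  (forall z, D z -> ProperFilter (increments D v z)) ->
  continuous h -> h 0 = 0 -> C1c D O f -> weight D O (h \o derive_within D f v).
Proof.
move=> PF ch h0 [[_ /(_ v)[_ /(continuous_up_to_refl _ _).1 cdf]] cK KO]; split.
  exact: within_continuous_comp.
exists (supp_in D f); split => // z Dz Kz /=.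
rewrite (@derive_within_eq0 _ _ _ D (supp_in D f) f v z (PF z Dz))//.
  exact: closed_closure.
by move=> y Dy Ky; exact: (supp_in_eq0 Dy Ky).
Qed.

Lemma weightM D O w f : weight D O w -> {within O, continuous f} ->
  weight D O (fun z => w z * f z).
Proof.
move=> [cw [K [cK KO w0]]] cf; split.
  exact: (within_continuousZ cw cf).
by exists K; split => // z Dz Kz; rewrite (w0 z Dz Kz) mul0r.
Qed.

(** On the compact set carrying w, the coefficient is bounded and m integrable;
    the rest of D does not contribute. *)
Lemma integrable_weight D O w m : measurable D -> measurable O ->
  weight D O w -> O `<=` D -> loc_integrable O m ->
  mu.-integrable D (EFin \o (fun z => w z * m z)).
Proof.
move=> mD mO [cw [K [cK KO w0]]] OD [mm mi].
have mK : measurable K by exact: compact_measurable_spacetime.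
suff iK : mu.-integrable K (EFin \o (fun z => w z * m z)).
  apply: (@integrable_mkcond _ _ _ mu D _ mD).2.
  have := (@integrable_mkcond _ _ _ mu K _ mK).1 iK; apply: eq_integrable => // z _.
  rewrite /patch; case: ifPn => zK; case: ifPn => zD //.
  - by move: zD; rewrite inE in zK; rewrite (mem_set (OD _ (KO _ zK))).
  - rewrite inE in zD; move/negP : zK; rewrite inE => zK.
    by rewrite /= (w0 _ zD zK) mul0r.
have mw : measurable_fun K w.
  by apply: measurable_funS (within_continuous_measurable mO cw).
have wK : compact (w @` K).
  by apply: continuous_compact => //; exact: continuous_subspaceW cw.
have [M [Mr wM]] := compact_bounded wK.
have bw : [bounded w z | z in K].
  by exists M; split => // r Mr' z Kz; apply: (wM r Mr'); exists z.
have iwm := @integrableMr _ _ _ mu K mK w (EFin \o m) mw bw (mi K cK KO).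
by apply: eq_integrable iwm.
Qed.

End local_integrability.

(** * Time slices and short time intervals *)

(** Dominated convergence is about sequences, and the integrands are only
    controlled for times in ]0, T]; restricting to such sequences is harmless. *)
Lemma cvg_at_right0_bounded (R : realType) (F : R -> R) (T l : R) : 0 < T ->
  (forall s : R^nat, (forall n, 0 < s n <= T) -> s @ \oo --> 0 ->
    F (s n) @[n --> \oo] --> l) ->
  F t @[t --> 0^'+] --> l.
Proof.
move=> T0 Fs; apply/cvg_at_rightP => r [r0 rcvg].
have rT : \forall n \near \oo, r n < T.
  exact: (rcvg _ (lt_nbhsl T0)).
have : F (Num.min (r n) T) @[n --> \oo] --> l.
  apply: Fs => [n|]; first by rewrite lt_min r0 T0 ge_min lexx orbT.
  apply: cvg_trans rcvg; apply: near_eq_cvg; apply: filterS rT => n rnT.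
  by rewrite min_l// ltW.
apply: cvg_trans; apply: near_eq_cvg; apply: filterS rT => n rnT.
by rewrite min_l// ltW.
Qed.

Section time_slices.
Context {R : realType} {d : nat}.
Local Notation spacetime := ('rV[R]_d * R)%type.
Local Notation vol := (lebesgue_rV d).
Local Notation leb1 := (@lebesgue_measure R).
Local Notation mu := (vol \x leb1)%E.
Variables (Om : set 'rV[R]_d) (T : R) (O : set spacetime).
Hypotheses (Om_open : open Om) (T_gt0 : 0 < T).
Local Notation D := (slab Om T).
Hypothesis O_open : relatively_open D O.

Lemma measurable_slab : measurable D.
Proof. by apply: measurableX => //; exact: open_measurable_rV. Qed.

Lemma relatively_open_sub : O `<=` D.
Proof. by have [A _ ->] := O_open; exact: subIsetl. Qed.

Lemma relatively_open_measurable : measurable O.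
Proof.
have [A oA ->] := O_open; apply: measurableI; first exact: measurable_slab.
exact: open_measurable_spacetime.
Qed.

Lemma ae_integrable_slice (f : spacetime -> R) : mu.-integrable D (EFin \o f) ->
  {ae leb1, forall tau, 0 < tau < T ->
    vol.-integrable Om (EFin \o (fun x => f (x, tau)))}.
Proof.
move=> /((@integrable_mkcond _ _ _ mu D _ measurable_slab).1).
move=> /ae_integrable2; apply: filterS => tau ftau /andP[tau0 tauT].
apply: (@integrable_mkcond _ _ _ vol Om _ (open_measurable_rV Om_open)).2.
apply: eq_integrable ftau => // x _; rewrite /patch.
have -> // : ((x, tau) \in D) = (x \in Om).
apply/idP/idP; rewrite !inE; first by case.
by move=> Omx; split => //=; rewrite in_itv/= !ltW.
Qed.

(** Absolute continuity of the integral: the sets Om x ]0, s n[ shrink to the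
    empty set, so dominated convergence applies with dominating function |g|. *)
Lemma cvg_integral_small_time (g : spacetime -> R) : mu.-integrable D (EFin \o g) ->
  \int[mu]_(z in Om `*` `]0, tau[) g z @[tau --> 0^'+] --> 0.
Proof.
move=> ig; apply: (cvg_at_right0_bounded T_gt0) => s sT s0.
pose A n : set spacetime := Om `*` `]0, s n[.
have mA n : measurable (A n) by apply: measurableX => //; exact: open_measurable_rV.
have AD n : A n `<=` D.
  move=> z [Omz]; rewrite /= in_itv/= => /andP[z0 zs]; split => //=.
  by rewrite in_itv/= ltW//= (le_trans (ltW zs))//; have /andP[] := sT n.
have mD := measurable_slab.
have [|||||_ _] := @dominated_convergence _ _ _ mu D mD
  (fun n => (EFin \o g) \_ (A n)) (cst 0%E) (abse \o (EFin \o g)).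
- move=> n; apply/(measurable_restrict _ (mA n) mD).
  by apply: measurable_funS (measurable_int _ ig).
- exact: measurable_cst.
- apply: aeW => z _; apply: cvg_near_cst.
  have [z0|z0] := ltP 0 z.2.
    have : \forall n \near \oo, s n < z.2 by exact: (s0 _ (lt_nbhsl z0)).
    apply: filterS => n sz; rewrite patchN//; apply/negP; rewrite inE => -[_].
    by rewrite /= in_itv/= => /andP[_]; rewrite ltNge ltW.
  apply: nearW => n; rewrite patchN//; apply/negP; rewrite inE => -[_].
  by rewrite /= in_itv/= => /andP[]; rewrite ltNge z0.
- exact: integrable_abse.
- apply: aeW => z n _; rewrite /patch; case: ifPn => // _.
  by rewrite abse0 abse_ge0.
rewrite integral0 => /fine_cvg; apply: cvg_trans; apply: near_eq_cvg.
apply: nearW => n; rewrite /= /Rintegral -integral_mkcondr.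
by rewrite (setIidr (AD n)).
Qed.

(** A dominating function independent of time, as needed to pass to the limit in
    the slices: a constant on the projection to space of the compact carrier. *)
Lemma weight_bound (w : spacetime -> R) : weight D O w ->
  exists2 b : 'rV[R]_d -> R, vol.-integrable Om (EFin \o b) &
    forall z, D z -> `|w z| <= b z.1.
Proof.
move=> [cw [K [cK KO w0]]].
have wK : compact (w @` K).
  by apply: continuous_compact => //; exact: continuous_subspaceW cw.
have [M [_ wM]] := compact_bounded wK; pose M1 := `|M| + 1.
have M1gt : M < M1 by rewrite (le_lt_trans (ler_norm M))// ltrDl.
pose B : set 'rV[R]_d := fst @` K.
have cB : compact B.
  by apply: continuous_compact => //; apply: continuous_subspaceT => z; exact: cvg_fst.
have mB : measurable B.
  rewrite -(setCK B); apply: measurableC; apply: open_measurable_rV.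
  exact/closed_openC/(compact_closed (@norm_hausdorff _ _) cB).
have volB : (vol B < +oo)%E by apply: compact_fin_vol => //; exact: compact_bounded.
exists (fun x => M1 * \1_B x).
  apply: (@integrableS _ _ _ vol setT) => //; first exact: open_measurable_rV.
  apply: (@integrableZl _ _ _ vol setT measurableT M1 (EFin \o \1_B)).
  apply/integrableP; split; first exact/measurable_EFinP.
  under eq_integral do rewrite /= ger0_norm ?indic_ge0//.
  by rewrite integral_indic// setIT.
move=> z Dz; have [Kz|Kz] := pselect (K z).
  rewrite indicE mem_set ?mulr1; last by exists z.
  by apply: (wM M1 M1gt); exists z.
by rewrite (w0 z Dz Kz) normr0 mulr_ge0// addr_ge0.
Qed.

(** Joint measurability on the slab is read off from [integrable_weight] with
    the locally integrable function 1. *)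
Lemma measurable_slice (w : spacetime -> R) tau : 0 <= tau <= T -> weight D O w ->
  measurable_fun Om (fun x => w (x, tau)).
Proof.
move=> tauT ww; have mD := measurable_slab.
have mw : measurable_fun D w.
  have := integrable_weight mD relatively_open_measurable ww relatively_open_sub
    (loc_integrable_cst relatively_open_measurable 1).
  move=> /measurable_int/measurable_EFinP.
  by apply: eq_measurable_fun => z _; rewrite mulr1.
apply: (measurable_comp mD _ mw).
  by move=> _ [x Omx <-]; split => //=; rewrite in_itv.
by apply: measurable_funTS; exact: measurable_pair2.
Qed.

Lemma integrable_weight_slice (w : spacetime -> R) tau : 0 <= tau <= T ->
  weight D O w -> vol.-integrable Om (EFin \o (fun x => w (x, tau))).
Proof.
move=> tauT ww; have [b ib wb] := weight_bound ww.
apply: le_integrable ib; first exact: open_measurable_rV.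
  by apply/measurable_EFinP; exact: (measurable_slice tauT ww).
move=> x Omx /=; rewrite lee_fin (le_trans (wb (x, tau) _)) ?ler_norm//.
Qed.

(** Relative openness of O is used here: if (x, 0) is in the carrier K, hence in
    O, then (x, t) is in O for small t, and w is continuous there; otherwise
    (x, t) avoids the closed set K for small t, and w vanishes. *)
Lemma cvg_weight_at0 (w : spacetime -> R) (x : 'rV[R]_d) (s : R^nat) : weight D O w ->
  Om x -> (forall n, 0 < s n <= T) -> s @ \oo --> 0 ->
  w (x, s n) @[n --> \oo] --> w (x, 0).
Proof.
move=> [/subspace_continuousP cw [K [cK KO w0]]] Omx sT s0.
have Ds n : D (x, s n).
  by split => //=; rewrite in_itv/=; have /andP[/ltW -> ->] := sT n.
have D0 : D (x, 0) by split => //=; rewrite in_itv/= lexx ltW.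
have xs : (x, s n) @[n --> \oo] --> (x, 0 : R) by exact: (cvg_pair (cvg_cst x) s0).
have [Kx|Kx] := pselect (K (x, 0)).
  apply: cvg_trans (cw _ (KO _ Kx)) => /=.
  move=> P wP.
  have [A oA OE] := O_open.
  have Ax : A (x, 0) by have := KO _ Kx; rewrite OE => -[].
  have As : \forall n \near \oo, A (x, s n) by apply: xs; exact: open_nbhs_nbhs.
  have Ps : \forall n \near \oo, O (x, s n) -> P (w (x, s n)) by exact: (xs _ wP).
  apply: filterS2 As Ps => n An /=; apply.
  by rewrite OE.
apply: cvg_near_cst; rewrite (w0 _ D0 Kx).
have nK : \forall n \near \oo, ~ K (x, s n).
  apply: (xs (~` K)); apply: open_nbhs_nbhs; split => //.
  exact/closed_openC/(compact_closed (@norm_hausdorff _ _) cK).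
by apply: filterS nK => n; exact: w0.
Qed.

Lemma cvg_integral_weight_slice (w : spacetime -> R) : weight D O w ->
  \int[vol]_(x in Om) w (x, tau) @[tau --> 0^'+] --> \int[vol]_(x in Om) w (x, 0).
Proof.
move=> ww; have [b ib wb] := weight_bound ww.
apply: (cvg_at_right0_bounded T_gt0) => s sT s0.
have sT' n : 0 <= s n <= T by have /andP[/ltW -> ->] := sT n.
have T0' : 0 <= (0 : R) <= T by rewrite lexx ltW.
have [|||||_ _] := @dominated_convergence _ _ _ vol Om (open_measurable_rV Om_open)
  (fun n x => (w (x, s n))%:E) (fun x => (w (x, 0))%:E) (EFin \o b).
- by move=> n; apply/measurable_EFinP; exact: (measurable_slice (sT' n) ww).
- by apply/measurable_EFinP; exact: (measurable_slice T0' ww).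
- apply: aeW => x Omx; apply: cvg_EFin; first exact: nearW.
  exact: cvg_weight_at0.
- exact: ib.
- apply: aeW => x n Omx; rewrite /= lee_fin; apply: (wb (x, s n)).
  by split => //=; rewrite in_itv/=.
have i0 := integrable_fin_num (open_measurable_rV Om_open)
  (integrable_weight_slice T0' ww).
rewrite -[X in _ --> X -> _]fineK//.
by move=> /fine_cvg.
Qed.

End time_slices.

Lemma ae_lebesgue_filter (R : realType) :
  Filter (almost_everywhere (@lebesgue_measure R)).
Proof. exact: ae_filter_ringOfSetsType. Qed.

(** The sign of E is only known on ]0, T[, which is enough as the essential
    liminf is a supremum over arbitrarily short intervals.  A positive essential
    infimum on ]0, r[ would exceed G on a shorter interval, which would then be
    negligible. *)
Lemma ess_liminf_0right_squeeze (R : realType) (E : R -> \bar R) (G : R -> R) (T : R) :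
  0 < T -> G t @[t --> 0^'+] --> 0 ->
  {ae @lebesgue_measure R, forall t, 0 < t < T -> (0 <= E t <= (G t)%:E)%E} ->
  ess_liminf_0right E = 0%E.
Proof.
move=> T0 G0 EG; apply/eqP; rewrite eq_le; apply/andP; split; last first.
  apply: (@le_trans _ _
    (ess_inf (mrestr (@lebesgue_measure R) (measurable_itv `]0, T[)) E)).
    apply/ess_infP; have [N [mN N0 sN]] := EG.
    exists (N `|` ~` `]0, T[); split.
    - by apply: measurableU => //; exact: measurableC.
    - rewrite /= /mrestr setIUl setICl setU0.
      by apply: (subset_measure0 _ mN) => //; exact: measurableI.
    - move=> t /= Et; have [tT|tT] := boolP (0 < t < T).
        by left; apply: sN => /= /(_ tT)/andP[].
      by right; rewrite /= in_itv/=; exact/negP.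
  by apply: ereal_sup_ubound; exists T.
apply: ge_ereal_sup => _ [r /= r0 <-]; rewrite leNgt; apply/negP => inf0.
set I := ess_inf _ _ in inf0.
have [delta delta0 leinf] : exists2 delta : R, 0 < delta & (delta%:E <= I)%E.
  case: I inf0 => [a|_|//]; last by exists 1 => //; rewrite leey.
  by rewrite lte_fin => a0; exists a.
have [s /= s0 Gs] : \forall t \near 0^'+, G t < delta.
  exact: (G0 _ (lt_nbhsl delta0)).
pose m := Num.min (Num.min r T) s.
have m0 : 0 < m by rewrite !lt_min r0 T0 s0.
have rae : {ae @lebesgue_measure R, forall t, 0 < t < r -> (I <= E t)%E}.
  have [N [mN N0 sN]] :=
    ess_inf_le (mrestr (@lebesgue_measure R) (measurable_itv `]0, r[)) E.
  exists (N `&` `]0, r[); split => //; first exact: measurableI.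
  move=> t /= /not_implyP[t0r It]; split; last by rewrite in_itv/=.
  exact: sN.
have : {ae @lebesgue_measure R, forall t, ~ `]0, m[%classic t}.
  apply: (@filterS2 _ _ (ae_lebesgue_filter R) _ _ _ _ rae EG) => t It Et.
  rewrite /= in_itv/= => /andP[t0 tm].
  move: tm; rewrite !lt_min -andbA => /and3P[tr tT ts].
  have := It; rewrite t0 tr => /(_ isT) IEt.
  have := Et; rewrite t0 tT => /(_ isT)/andP[_ EGt].
  have Gt : G t < delta by apply: Gs => //=; rewrite sub0r normrN gtr0_norm.
  have : (delta%:E <= (G t)%:E)%E by rewrite (le_trans leinf)// (le_trans IEt).
  by rewrite lee_fin leNgt Gt.
move=> [N [mN N0 sN]].
have : @lebesgue_measure R `]0, m[%classic = 0%E.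
  apply: (subset_measure0 _ mN _ N0) => //.
  by move=> t tm; apply: sN => /=; exact.
rewrite lebesgue_measure_itv/= lte_fin m0 oppr0 adde0 => -[m00].
by rewrite m00 ltxx in m0.
Qed.

(** * Integrability of the energy and momentum fluxes *)

Lemma id_cts (R : realType) : continuous (id : R -> R).
Proof. by move=> ?; exact: cvg_id. Qed.

Lemma C1c_sub (R : realType) (V W : normedModType R) (D O : set V) (f : V -> W) :
  O `<=` D -> C1c D D f -> supp_in D f `<=` O -> C1c D O f.
Proof. by move=> OD [C1f cf _] fO; split => //; exact: C1_up_to_subset C1f. Qed.

Section integrands.
Context {R : realType} {d : nat}.
Local Notation spacetime := ('rV[R]_d * R)%type.
Local Notation vol := (lebesgue_rV d).
Local Notation leb1 := (@lebesgue_measure R).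
Local Notation mu := (vol \x leb1)%E.
Variables (Om : set 'rV[R]_d) (T : R) (O : set spacetime).
Hypotheses (Om_open : open Om) (T_gt0 : 0 < T).
Local Notation D := (slab Om T).
Hypothesis O_open : relatively_open D O.
Variables (u : spacetime -> 'rV[R]_d) (p : spacetime -> R).
Hypothesis u3 : forall i, Lloc O 3 (fun z => u z ord0 i).
Hypothesis p32 : Lloc O (3 / 2) p.

Let mD := measurable_slab T Om_open.
Let mO := relatively_open_measurable Om_open O_open.
Let OD := relatively_open_sub O_open.
Let PF z v (Dz : D z) := increments_proper Om_open T_gt0 v Dz.

Let weightP w m : weight D O w -> loc_integrable O m ->
  mu.-integrable D (EFin \o (fun z => w z * m z)).
Proof. by move=> ww lm; exact: (integrable_weight mD mO ww OD lm). Qed.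

Let coord0 i : (0 : 'rV[R]_d) ord0 i = 0.
Proof. by rewrite mxE. Qed.

Lemma loc_integrable_dot : loc_integrable O (fun z => dot (u z) (u z)).
Proof.
exact: (loc_integrable_sum (fun i => loc_integrable_mul2 mO (u3 i) (u3 i))).
Qed.

Lemma integrable_energy (chi : spacetime -> R) : C1c D O chi ->
  mu.-integrable D (EFin \o (fun z => chi z * dot (u z) (u z))).
Proof.
move=> C1chi; apply: weightP loc_integrable_dot.
exact: (@weight_C1c _ _ R _ _ chi id (@id_cts _) erefl C1chi).
Qed.

(** The cubic flux |u|^2 u is a sum of products of three components, each in
    the local L^3 space, and p u pairs the exponents 3/2 and 3. *)
Lemma integrable_energy_flux (chi : spacetime -> R) : C1c D O chi ->
  mu.-integrable D (EFin \o (fun z =>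
    2^-1 * d_t D chi z * dot (u z) (u z) +
    dot (grad D chi z) ((dot (u z) (u z) / 2 + p z) *: u z))).
Proof.
move=> C1chi.
have wd v : weight D O (derive_within D chi v).
  apply: (@weight_derive_within _ _ R _ _ chi id v _ (@id_cts _) erefl C1chi).
  by move=> z Dz; exact: PF.
have i1 := weightP (wd (0, 1)) (loc_integrable_scale 2^-1 loc_integrable_dot).
have lflux j : loc_integrable O (fun z =>
    2^-1 * (\sum_i u z ord0 i * u z ord0 i * u z ord0 j) + p z * u z ord0 j).
  apply: loc_integrable_add; last exact: (loc_integrable_mul32 mO).
  apply: loc_integrable_scale; apply: loc_integrable_sum => i.
  exact: (loc_integrable_mul3 mO).
have i2 := integrable_bigsum mD
  (fun j : 'I_d => weightP (wd (delta_mx ord0 j, 0)) (lflux j)).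
apply: eq_integrable (integrable_add mD i1 i2) => // z _ /=; congr EFin.
congr (_ + _); first by rewrite /d_t mulrCA mulrA.
apply: eq_bigr => j _; rewrite !mxE /d_x; congr (_ * _).
by rewrite -mulr_suml /dot; ring.
Qed.

Lemma integrable_momentum (zeta : spacetime -> 'rV[R]_d) : C1c D O zeta ->
  mu.-integrable D (EFin \o (fun z => dot (u z) (zeta z))).
Proof.
move=> C1z.
have wz i : weight D O (fun z => zeta z ord0 i).
  apply: (@weight_C1c _ _ _ _ _ _ (fun v : 'rV[R]_d => v ord0 i)) C1z => //.
  exact: coord_continuous.
have i1 := integrable_bigsum mD
  (fun i : 'I_d => weightP (wz i) (loc_integrable_Lloc3 mO (u3 i))).
apply: eq_integrable i1 => // z _ /=; congr EFin.
by apply: eq_bigr => i _; rewrite mulrC.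
Qed.

Lemma integrable_momentum_flux (zeta : spacetime -> 'rV[R]_d) : C1c D O zeta ->
  mu.-integrable D (EFin \o (fun z =>
    dot (d_t D zeta z) (u z) +
    \sum_(i < d) \sum_(j < d)
       d_x D j zeta z ord0 i * (u z ord0 i * u z ord0 j) +
    p z * divergence D zeta z)).
Proof.
move=> C1z.
have wd v i : weight D O (fun z => derive_within D zeta v z ord0 i).
  apply: (@weight_derive_within _ _ _ _ _ _ (fun v : 'rV[R]_d => v ord0 i)) C1z => //.
    by move=> z Dz; exact: PF.
  exact: coord_continuous.
have i1 := integrable_bigsum mD
  (fun i : 'I_d => weightP (wd (0, 1) i) (loc_integrable_Lloc3 mO (u3 i))).
have i2 := integrable_bigsum mD (fun i : 'I_d => integrable_bigsum mD (fun j : 'I_d =>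
  weightP (wd (delta_mx ord0 j, 0) i) (loc_integrable_mul2 mO (u3 i) (u3 j)))).
have i3 := integrable_bigsum mD (fun j : 'I_d =>
  weightP (wd (delta_mx ord0 j, 0) j) (loc_integrable_Lloc32 mO p32)).
apply: eq_integrable (integrable_add mD (integrable_add mD i1 i2) i3) => // z _ /=.
congr EFin; congr (_ + _).
by rewrite /divergence mulr_sumr; apply: eq_bigr => j _; rewrite mulrC.
Qed.

End integrands.

(** * The relative energy at short times *)

Lemma dotBB (R : realType) (d : nat) (a b : 'rV[R]_d) :
  dot (a - b) (a - b) = dot a a - 2 * dot a b + dot b b.
Proof.
rewrite /dot mulr_sumr -sumrB -big_split/=; apply: eq_bigr => i _.
by rewrite !mxE; ring.
Qed.

Lemma dotZr (R : realType) (d : nat) (k : R) (a b : 'rV[R]_d) :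
  dot a (k *: b) = k * dot a b.
Proof.
by rewrite /dot mulr_sumr; apply: eq_bigr => i _; rewrite mxE mulrCA.
Qed.

Lemma dot_ge0 (R : realType) (d : nat) (a : 'rV[R]_d) : 0 <= dot a a.
Proof. by apply: sumr_ge0 => i _; rewrite -expr2 sqr_ge0. Qed.

Theorem corollary4p1 (R : realType) (d : nat) (hd : (0 < d)%N)
    (Om : set 'rV[R]_d) (Om_open : open Om) (Om_connected : connected Om)
    (Om_nonempty : Om !=set0)
    (T : R) (T_gt0 : 0 < T)
    (phi : 'rV[R]_d * R -> R)
    (phi_C1c : C1c (slab Om T) (slab Om T) phi)
    (phi_ge0 : forall z, slab Om T z -> 0 <= phi z)
    (O : set ('rV[R]_d * R)) (O_open : relatively_open (slab Om T) O)
    (phi_supp : supp_in (slab Om T) phi `<=` O)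
    (u0 : 'rV[R]_d -> 'rV[R]_d)
    (u : 'rV[R]_d * R -> 'rV[R]_d) (p : 'rV[R]_d * R -> R)
    (u_admissible : admissible_weak_solution Om T O u p u0)
    (U : 'rV[R]_d * R -> 'rV[R]_d) (P : 'rV[R]_d * R -> R)
    (U_strong : strong_solution Om T O U P)
    (u0_C1 : C1_up_to Om (initial_slice O) (initial_slice (closure O)) u0)
    (U_initial : forall x, initial_slice O x -> U (x, 0) = u0 x) :
  ess_liminf_0right (E_rel Om phi u U) = 0%E.
Proof.
have [[u3 p32 momentum _] energy] := u_admissible.
have [U_C1 _ _] := U_strong.
have OD := relatively_open_sub O_open.
have mOm := open_measurable_rV Om_open.
have phi_O : C1c (slab Om T) O phi by exact: C1c_sub.
pose zeta z := phi z *: U z.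
have zeta_O : C1c (slab Om T) O zeta.
  apply: C1c_scale => // z v Oz.
  by apply: increments_proper => //; exact: OD.
have phi_out z : slab Om T z -> ~ O z -> phi z = 0.
  by move=> Dz Oz; apply: (supp_in_eq0 Dz) => /phi_supp.
(* W is the density of the third term, and at time 0 of all three *)
pose W z := phi z * dot (U z) (U z).
have wW : weight (slab Om T) O W.
  apply: weightM; first exact: (@weight_C1c _ _ R _ _ phi id (@id_cts _) erefl phi_O).
  have [/(continuous_up_to_refl O U).1 cU _] :=
    C1_up_to_subset (@subset_refl _ O) (@subset_closure _ O) U_C1.
  apply/subspace_continuousP => z Oz; rewrite /dot.
  apply: cvg_big => [|i _]; first exact: add_continuous.
  have cUi : U z' ord0 i @[z' --> within O (nbhs z)] --> U z ord0 i.
    have /subspace_continuousP :=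
      within_continuous_comp cU (@coord_continuous _ 1 d ord0 i).
    exact.
  exact: cvgM.
(* off O both sides vanish with phi, so the initial condition on O suffices *)
have W0 x : Om x -> W (x, 0) = phi (x, 0) * dot (u0 x) (u0 x) /\
    W (x, 0) = dot (u0 x) (zeta (x, 0)).
  move=> Omx; rewrite dotZr /W.
  have [Ox|Ox] := pselect (O (x, 0)); first by rewrite U_initial.
  rewrite phi_out ?mul0r//.
  by split => //=; rewrite in_itv/= lexx ltW.
pose F1 tau := \int[(lebesgue_rV d \x @lebesgue_measure R)%E]_(z in Om `*` `]0, tau[)
  (2^-1 * d_t (slab Om T) phi z * dot (u z) (u z) +
    dot (grad (slab Om T) phi z) ((dot (u z) (u z) / 2 + p z) *: u z)).
pose F2 tau := \int[(lebesgue_rV d \x @lebesgue_measure R)%E]_(z in Om `*` `]0, tau[)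
  (dot (d_t (slab Om T) zeta z) (u z) +
    \sum_(i < d) \sum_(j < d)
       d_x (slab Om T) j zeta z ord0 i * (u z ord0 i * u z ord0 j) +
    p z * divergence (slab Om T) zeta z).
pose IW tau := \int[lebesgue_rV d]_(x in Om) W (x, tau).
pose G tau := F1 tau - F2 tau + 2^-1 * (IW tau - IW 0).
apply: (@ess_liminf_0right_squeeze _ _ G T) => //.
  suff : G t @[t --> 0^'+] --> 0 - 0 + 2^-1 * (IW 0 - IW 0).
    by rewrite !subrr mulr0 addr0.
  apply: cvgD.
    apply: cvgB.
      exact: (cvg_integral_small_time Om_open T_gt0
        (integrable_energy_flux Om_open T_gt0 O_open u3 p32 phi_O)).
    exact: (cvg_integral_small_time Om_open T_gt0
      (integrable_momentum_flux Om_open T_gt0 O_open u3 p32 zeta_O)).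
  apply: cvgM; first exact: cvg_cst.
  apply: cvgB; last exact: cvg_cst.
  exact: (cvg_integral_weight_slice Om_open T_gt0 O_open wW).
have aeA := ae_integrable_slice Om_open (integrable_energy Om_open O_open u3 phi_O).
have aeB := ae_integrable_slice Om_open (integrable_momentum Om_open O_open u3 zeta_O).
have aeE := energy phi phi_O phi_ge0.
have FF := ae_lebesgue_filter R.
have aeAB := @filterI _ _ FF _ _ aeA aeB.
have aeEM := @filterI _ _ FF _ _ aeE momentum.
apply: (@filterS2 _ _ FF _ _ _ _ aeAB aeEM) => tau [iA iB] [eE eM] tau0T.
have /andP[tau0 tauT] := tau0T.
have tau0T' : 0 <= tau <= T by rewrite !ltW.
have T0' : 0 <= (0 : R) <= T by rewrite lexx ltW.
have {}iA := iA tau0T; have {}iB := iB tau0T.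
have {}eE := eE tau0T; have {}eM := eM tau0T zeta zeta_O.
have iW t (t0T : 0 <= t <= T) := integrable_weight_slice Om_open O_open t0T wW.
apply/andP; split.
  apply: mule_ge0; first by rewrite lee_fin.
  apply: integral_ge0 => x Omx; rewrite lee_fin mulr_ge0 ?dot_ge0// phi_ge0//.
pose IA := \int[lebesgue_rV d]_(x in Om) (phi (x, tau) * dot (u (x, tau)) (u (x, tau))).
pose IB := \int[lebesgue_rV d]_(x in Om) dot (u (x, tau)) (zeta (x, tau)).
(* finiteness of all three slice integrals allows the extended-real integral to
   be computed as a combination of real ones *)
have E_eq : E_rel Om phi u U tau = (2^-1 * (IA - 2 * IB + IW tau))%:E.
  rewrite /E_rel EFinM; congr (_ * _)%E.
  have i2B : (lebesgue_rV d).-integrable Om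
      (EFin \o (fun x => 2 * dot (u (x, tau)) (zeta (x, tau)))).
    exact: (@integrableZl _ _ _ _ Om mOm 2 _ iB).
  have iAB := integrableB mOm iA i2B.
  rewrite -RintegralZl// -RintegralB// -RintegralD//; last exact: iW.
  have iABW := integrableD mOm iAB (iW _ tau0T').
  rewrite /Rintegral fineK; last exact: (integrable_fin_num mOm iABW).
  apply: eq_integral => x _; congr EFin.
  by rewrite dotBB /W dotZr; ring.
rewrite E_eq lee_fin.
move: eE eM; rewrite -/(F1 tau) -/(F2 tau) -/IA.
rewrite (RintegralB mOm iB); last first.
  apply: eq_integrable (iW 0 T0') => // x; rewrite inE => Omx /=.
  by rewrite -(W0 x Omx).2.
have -> : \int[lebesgue_rV d]_(x in Om) (phi (x, 0) * dot (u0 x) (u0 x)) = IW 0.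
  by apply: eq_Rintegral => x; rewrite inE => Omx; rewrite -(W0 x Omx).1.
have -> : \int[lebesgue_rV d]_(x in Om) dot (u0 x) (zeta (x, 0)) = IW 0.
  by apply: eq_Rintegral => x; rewrite inE => Omx; rewrite -(W0 x Omx).2.
rewrite -/IB /G => eE ->; lra.
Qed.
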